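(* Let $d\ge1$, $L>0$, and let $c_0>0$ be a constant. For integers $M\ge2$, $n\ge1$ with $M\le c_0n$, $\psi_n(M)=LM/n$ is the optimal rate of linear aggregation over $\mathcal{P}_0$ (that is, the optimal rate of aggregation for $H=\mathbb{R}^M$ over $\mathcal{P}_0$), and the linear aggregate $\tilde p_n^{\mathbf L}$ is a rate optimal aggregate for $\mathbb{R}^M$ over $\mathcal{P}_0$. Explicitly, there are constants $C<\infty$ and $c>0$ independent of $M$ and $n$ such that for every $M\ge2$: (i) for any functions $p_1,\dots,p_M\in L_2(\mathbb{R}^d)$ and any $n\ge1$ with $M\le c_0n$, $$\sup_{p\in\mathcal{P}_0}\Big[R_n(\tilde p_n^{\mathbf L},p)-\inf_{\lambda\in\mathbb{R}^M}\|\mathsf{p}_\lambda-p\|^2\Big]\le C\,\frac{LM}{n};$$ (ii) there exist functions $p_1,\dots,p_M\in L_2(\mathbb{R}^d)$ such that for any $n\ge1$ with $M\le c_0n$ and all estimators $T_n$ of $p$ based on $X_1,\dots,X_n$, $$\sup_{p\in\mathcal{P}_0}\Big[R_n(T_n,p)-\inf_{\lambda\in\mathbb{R}^M}\|\mathsf{p}_\lambda-p\|^2\Big]\ge c\,\frac{LM}{n}.$$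
   Context: $X_1,\dots,X_n$ are i.i.d. random vectors in $\mathbb{R}^d$ with density $p$. $\|\cdot\|$ is the $L_2(\mathbb{R}^d)$ norm and $\|\cdot\|_\infty$ the $L_\infty(\mathbb{R}^d)$ norm. $\mathcal{P}_0$ is the class of all probability densities $p$ on $\mathbb{R}^d$ with $\|p\|_\infty\le L$. For $\lambda\in\mathbb{R}^M$, $\mathsf{p}_\lambda=\sum_{j=1}^M\lambda_jp_j$. For an estimator $T_n$, $R_n(T_n,p)=E_p^n\|T_n-p\|^2$, where $E_p^n$ is the expectation under density $p$. Linear aggregate: if $\phi_1,\dots,\phi_{M'}$ ($M'\le M$) is an orthonormal basis in $L_2(\mathbb{R}^d)$ of the linear span of $p_1,\dots,p_M$, then $\tilde p_n^{\mathbf L}=\sum_{j=1}^{M'}\hat\lambda_j^{\mathbf L}\phi_j$ with $\hat\lambda_j^{\mathbf L}=\frac1n\sum_{i=1}^n\phi_j(X_i)$. Definition (optimal rate of aggregation): for a class $\mathcal{P}$ of densities and $H\subseteq\mathbb{R}^M$, positive numbers $\psi_n(M)$ are called an optimal rate of aggregation for $H$ over $\mathcal{P}$ if (a) for any $p_1,\dots,p_M\in L_2(\mathbb{R}^d)$ there is an estimator $\tilde p_n$ with $\sup_{p\in\mathcal{P}}[R_n(\tilde p_n,p)-\inf_{\lambda\in H}\|\mathsf{p}_\lambda-p\|^2]\le C\psi_n(M)$ for any integer $n\ge1$, with $C<\infty$ independent of $M,n$; and (b) there exist $p_1,\dots,p_M\in L_2(\mathbb{R}^d)$ such that for all estimators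 $T_n$, $\sup_{p\in\mathcal{P}}[R_n(T_n,p)-\inf_{\lambda\in H}\|\mathsf{p}_\lambda-p\|^2]\ge c\psi_n(M)$ for any integer $n\ge1$, with $c>0$ independent of $M,n$. When (b) holds, an aggregate satisfying (a) is called rate optimal for $H$ over $\mathcal{P}$. Here the definition is applied with $n$ restricted to $M\le c_0n$. *)

(* Defs.v *)
From HB Require Import structures.
From mathcomp Require Import all_boot all_order all_algebra.
From mathcomp Require Import all_classical all_reals all_analysis.

Set Implicit Arguments.
Unset Strict Implicit.
Unset Printing Implicit Defensive.

Import Order.TTheory GRing.Theory Num.Theory.
Import numFieldNormedType.Exports.

Local Open Scope classical_set_scope.
Local Open Scope ring_scope.

(* The image of mu \x nu under (x, y) |-> x :: y. *)
Section pushforward_cons.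
Context d (T : measurableType d) (R : realType) (n : nat).
Variables (mu : {sigma_finite_measure set T -> \bar R})
  (nu : {sigma_finite_measure set (n.-tuple T) -> \bar R}).

Definition cons_pair (z : T * n.-tuple T) : n.+1.-tuple T :=
  [the n.+1.-tuple T of z.1 :: z.2].

Definition uncons (x : n.+1.-tuple T) : T * n.-tuple T :=
  (thead x, [tuple of behead x]).

Lemma cons_pairK : cancel cons_pair uncons.
Proof.
move=> [a b]; rewrite /uncons /cons_pair/= theadE; congr pair; exact: val_inj.
Qed.

Lemma unconsK : cancel uncons cons_pair.
Proof. by move=> x; rewrite [RHS]tuple_eta; exact: val_inj. Qed.

Lemma preimage_cons_uncons S : cons_pair @^-1` (uncons @^-1` S) = S.
Proof. by apply/funext => z; apply: (congr1 S); exact: cons_pairK. Qed.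

Lemma measurable_uncons : measurable_fun [set: n.+1.-tuple T] uncons.
Proof.
apply: measurable_fun_pair; last exact: measurable_behead.
exact: (@measurable_tnth _ T n.+1 ord0).
Qed.

Lemma measurable_cons_pair : measurable_fun [set: T * n.-tuple T] cons_pair.
Proof. exact: measurable_cons. Qed.

Definition cons_measure : set (n.+1.-tuple T) -> \bar R :=
  pushforward (mu \x nu)%E cons_pair.

Let mcons (B : set (n.+1.-tuple T)) :
  measurable B -> measurable (cons_pair @^-1` B).
Proof. by move=> mB; rewrite -[X in measurable X]setTI; exact: measurable_cons_pair. Qed.

Let cons_measure0 : cons_measure set0 = 0%E.
Proof. by rewrite /cons_measure /pushforward preimage_set0 measure0. Qed.

Let cons_measure_ge0 A : (0 <= cons_measure A)%E.
Proof. by rewrite /cons_measure /pushforward; exact: measure_ge0. Qed.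

Let cons_measure_sigma_additive : semi_sigma_additive cons_measure.
Proof.
move=> F mF tF mUF; rewrite /cons_measure /pushforward preimage_bigcup.
apply: measure_semi_sigma_additive.
- by move=> k; exact: mcons.
- apply/trivIsetP => /= i j _ _ ij; rewrite -preimage_setI.
  by move/trivIsetP : tF => /(_ _ _ _ _ ij) ->//; rewrite preimage_set0.
- by rewrite -preimage_bigcup; exact: mcons.
Qed.

HB.instance Definition _ := isMeasure.Build _ _ _ cons_measure
  cons_measure0 cons_measure_ge0 cons_measure_sigma_additive.

Lemma cons_measure_rect (A : set T) (B : set (n.-tuple T)) :
  measurable A -> measurable B ->
  cons_measure (uncons @^-1` (A `*` B)) = (mu A * nu B)%E.
Proof.
move=> mA mB; rewrite /cons_measure /pushforward preimage_cons_uncons.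
exact: product_measure1E.
Qed.

Let cons_measure_sigma_finite : sigma_finite setT cons_measure.
Proof.
have /sigma_finiteP[F [TF ndF Foo]] := sigma_finiteT mu.
have /sigma_finiteP[G [TG ndG Goo]] := sigma_finiteT nu.
exists (fun k => uncons @^-1` (F k `*` G k)).
  apply/esym; rewrite -subTset => x _.
  have [i _ Fi] : (\bigcup_k F k) (uncons x).1 by rewrite -TF.
  have [j _ Gj] : (\bigcup_k G k) (uncons x).2 by rewrite -TG.
  exists (maxn i j) => //; split.
  - by move: Fi; exact/subsetPset/ndF/leq_maxl.
  - by move: Gj; exact/subsetPset/ndG/leq_maxr.
move=> k; have [mF Fk] := Foo k; have [mG Gk] := Goo k; split.
  rewrite -[X in measurable X]setTI; apply: measurable_uncons => //.
  exact: measurableX.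
by rewrite cons_measure_rect// lte_mul_pinfty// ge0_fin_numE.
Qed.

HB.instance Definition _ :=
  Measure_isSigmaFinite.Build _ _ _ cons_measure cons_measure_sigma_finite.

End pushforward_cons.

(* The n-fold product of mu on n.-tuple T, characterised by its values on
   rectangles (tuple_measure_rect). *)
Fixpoint tuple_measure d (T : measurableType d) (R : realType)
    (mu : {sigma_finite_measure set T -> \bar R}) (n : nat) :
    {sigma_finite_measure set (n.-tuple T) -> \bar R} :=
  match n return {sigma_finite_measure set (n.-tuple T) -> \bar R} with
  | 0 => \d_ ([tuple] : 0.-tuple T)
  | k.+1 => cons_measure mu (tuple_measure mu k)
  end.

Lemma tuple_measure_rect d (T : measurableType d) (R : realType)
    (mu : {sigma_finite_measure set T -> \bar R}) (n : nat)
    (A : 'I_n -> set T) : (forall i, measurable (A i)) ->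
  tuple_measure mu n [set x | forall i, A i (tnth x i)]
  = (\prod_(i < n) mu (A i))%E.
Proof.
elim: n A => [|n IHn] A mA.
  by rewrite big_ord0 /= diracE mem_set// => -[].
rewrite big_ord_recl -IHn// -cons_measure_rect//; last first.
  rewrite (_ : mkset _ = \bigcap_(i : 'I_n)
      ((fun x : n.-tuple T => tnth x i) @^-1` A (lift ord0 i))).
    apply: fin_bigcap_measurable => // i _; rewrite -[X in measurable X]setTI.
    by apply: measurable_tnth.
  by apply/seteqP; split=> x /= Ax i; move=> *; apply: Ax.
congr (cons_measure _ _ _).
have tS (x : n.+1.-tuple T) i :
    tnth x (lift ord0 i) = tnth [tuple of behead x] i.
  by rewrite [in LHS](tuple_eta x) tnthS.
apply/seteqP; split=> x /=.
  by move=> Ax; split=> [|i]; [exact: Ax ord0|rewrite -tS; exact: Ax].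
move=> [A0 Ax] i; case: (unliftP ord0 i) => [j ->|->]; last exact: A0.
by rewrite tS; exact: Ax.
Qed.

Notation Rspace R d := (d.-tuple (measurableTypeR R)).

Definition lebesgueR (R : realType) (d : nat) :
    {sigma_finite_measure set (Rspace R d) -> \bar R} :=
  tuple_measure (@lebesgue_measure R) d.

Section aggregation.
Context {R : realType} {d : nat}.

Local Notation Rd := (Rspace R d).
Local Notation leb := (lebesgueR R d).

Definition sqL2 (f : Rd -> R) : \bar R := (('N[leb]_2%:E[EFin \o f]) ^+ 2)%E.

Definition is_density (p : Rd -> R) : Prop :=
  [/\ measurable_fun setT p, (forall x, 0 <= p x)
    & (\int[leb]_x (p x)%:E)%E = 1%E].

Definition bounded_densities (L : R) : set (Rd -> R) :=
  [set p | is_density p /\ ('N[leb]_+oo[EFin \o p] <= L%:E)%E].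

(* [sample_expectation p F] is E_p^n F(X_1, ..., X_n), the sample having the joint
   density p(x_1) ... p(x_n) with respect to Lebesgue measure on (R^d)^n. *)
Definition sample_expectation (n : nat) (p : Rd -> R) (F : n.-tuple Rd -> \bar R) :
    \bar R :=
  (\int[tuple_measure leb n]_x (F x * (\prod_(i < n) p (tnth x i))%:E))%E.

(* An estimator sends the sample to a function on R^d. Its values need not be
   square integrable: in that case the loss is +oo. *)
Definition estimator (n : nat) := n.-tuple Rd -> Rd -> R.

Definition is_estimator (n : nat) (T : estimator n) : Prop :=
  measurable_fun [set: n.-tuple Rd * Rd] (fun z => T z.1 z.2).

Definition risk (n : nat) (T : estimator n) (p : Rd -> R) : \bar R :=
  sample_expectation p (fun x => sqL2 (T x \- p)).

Definition mixture (M : nat) (f : 'I_M -> Rd -> R) (lam : 'rV[R]_M) : Rd -> R :=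
  fun x => \sum_(j < M) lam ord0 j * f j x.

Definition oracle_error (M : nat) (f : 'I_M -> Rd -> R) (H : set 'rV[R]_M)
    (p : Rd -> R) : \bar R :=
  ereal_inf [set sqL2 (mixture f lam \- p) | lam in H].

(* For square integrable [f] and [p] and nonempty [H] the oracle error is
   finite, so that no difference below has the form +oo - +oo. *)
Definition max_excess_risk (M n : nat) (P : set (Rd -> R)) (H : set 'rV[R]_M)
    (f : 'I_M -> Rd -> R) (T : estimator n) : \bar R :=
  ereal_sup [set (risk T p - oracle_error f H p)%E | p in P].

(* [dom M n] is the range of (M, n) to which the definition is restricted. *)
Definition optimal_rate_of_aggregation (dom : nat -> nat -> Prop)
    (P : set (Rd -> R)) (H : forall M, set 'rV[R]_M) (psi : nat -> nat -> R) :
    Prop :=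
  [/\ forall M n, (2 <= M)%N -> (1 <= n)%N -> dom M n -> 0 < psi M n,
      exists C : R, forall M, (2 <= M)%N ->
        forall f : 'I_M -> Rd -> R, (forall j, f j \in Lfun leb 2%:E) ->
        exists T : forall n, estimator n, forall n, (1 <= n)%N -> dom M n ->
          is_estimator (T n) /\
          (max_excess_risk P (H M) f (T n) <= (C * psi M n)%:E)%E
    & exists c : R, 0 < c /\ forall M, (2 <= M)%N ->
        exists f : 'I_M -> Rd -> R, (forall j, f j \in Lfun leb 2%:E) /\
        forall n, (1 <= n)%N -> dom M n ->
        forall T : estimator n, is_estimator T ->
          ((c * psi M n)%:E <= max_excess_risk P (H M) f T)%E].

(* Elements of L_2 are classes modulo a.e. equality, hence the a.e. equalities
   expressing that [phi] and [f] have the same linear span. *)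
Definition orthonormal_basis_of_span (M M' : nat) (f : 'I_M -> Rd -> R)
    (phi : 'I_M' -> Rd -> R) : Prop :=
  [/\ forall j, phi j \in Lfun leb 2%:E,
      forall i j, (\int[leb]_x (phi i x * phi j x)%:E)%E = (i == j)%:R%:E,
      forall j, exists a : 'rV[R]_M, phi j = mixture f a %[ae leb]
    & forall j, exists b : 'rV[R]_M', f j = mixture phi b %[ae leb]].

Definition linear_aggregate (M' : nat) (phi : 'I_M' -> Rd -> R) (n : nat) :
    estimator n :=
  fun x => mixture phi (\row_j (n%:R^-1 * \sum_(i < n) phi j (tnth x i))).

End aggregation.

Arguments linear_aggregate {R d M'} phi n _.

(* Main.v *)
Require Import Defs.
From mathcomp Require Import all_boot all_order all_algebra.
From mathcomp Require Import all_classical all_reals all_analysis.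
From mathcomp Require Import ess_sup_inf measurable_realfun ring lra.

Set Implicit Arguments.
Unset Strict Implicit.
Unset Printing Implicit Defensive.

Import Order.TTheory GRing.Theory Num.Theory.
Import numFieldNormedType.Exports.

Local Open Scope classical_set_scope.
Local Open Scope ring_scope.

(** Upper bound. In an orthonormal basis phi_1, ..., phi_M' of the span, the squared
    distance from sum_j b_j phi_j to p is sum_j (b_j - <phi_j, p>)^2 plus the
    squared error of the projection of p, which is the oracle error. The estimated
    coefficients are unbiased with variance at most E_p phi_j(X)^2 / n <= L / n,
    so the excess risk is at most L M' / n.

    Lower bound (Assouad). Split a box of volume 1 / (L/2) into M - 1 bins, each cut
    into two halves, and let om in {-1, 1}^(M-1) perturb the uniform density L/2 by
    a factor 1 +- h, with opposite signs on the two halves of each bin. These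
    densities lie in the span of M fixed functions, so the oracle error vanishes.
    With h^2 of order M / n, flipping one sign changes the product density of the
    sample by a bounded Hellinger distance; hence the loss on each bin, averaged
    over the sign, is at least of order L^2 h^2 / (L M), and summing over the
    bins gives L h^2, of order L M / n. *)

(** * Inner products and orthonormal bases in L2 *)

Section L2.
Context d (T : measurableType d) (R : realType).
Variable mu : {measure set T -> \bar R}.
Implicit Types (f g h : T -> R).

Local Notation L2 := (Lfun mu 2%:E).

(** Both sides may be [+oo], so the identity also covers the loss of an estimator whose values are
    not square integrable. *)
Lemma sqr_Lnorm2 f :
  ('N[mu]_2%:E[EFin \o f] ^+ 2 = \int[mu]_x (f x ^+ 2)%:E)%E.
Proof.
rewrite unlock poweR12_sqrt; last first.
  by apply: integral_ge0 => x _; exact: poweR_ge0.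
rewrite sqr_sqrte; last by apply: integral_ge0 => x _; exact: poweR_ge0.
apply: eq_integral => x _ /=.
by rewrite powR_mulrn ?normr_ge0// real_normK ?num_real.
Qed.

Lemma Lfun2_measurable f : f \in L2 -> measurable_fun setT f.
Proof. by rewrite inE => /andP[/[!inE]]. Qed.

Lemma Lfun2P f : measurable_fun setT f ->
  (\int[mu]_x (f x ^+ 2)%:E < +oo)%E -> f \in L2.
Proof.
move=> mf foo; rewrite inE; apply/andP; split; rewrite inE//=.
rewrite /finite_norm; move: foo; rewrite -sqr_Lnorm2 expe2.
case: ('N[mu]_2%:E[EFin \o f])%E (Lnorm_ge0 mu 2%:E (EFin \o f)) => //=.
by move=> r _ _; rewrite ltry.
Qed.

Lemma Lfun2Z a f : f \in L2 -> (fun x => a * f x) \in L2.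
Proof.
move=> fL; rewrite (_ : (fun _ => _) = a \o* f).
  by apply: Lfun_scale => //; exact: ler1n.
by apply/funext => x /=; rewrite mulrC.
Qed.

Lemma Lfun2D f g : f \in L2 -> g \in L2 -> (f \+ g) \in L2.
Proof.
by move=> fL gL; exact: (@Lfun_addr_closed _ _ _ mu 2%:E (lee1n 2)).2.
Qed.

Lemma Lfun2B f g : f \in L2 -> g \in L2 -> (f \- g) \in L2.
Proof.
move=> fL gL; rewrite (_ : f \- g = f \+ (fun x => -1 * g x)).
  by apply: Lfun2D => //; exact: Lfun2Z.
by apply/funext => x /=; rewrite mulN1r.
Qed.

Lemma Lfun2_sum (I : Type) (s : seq I) (a : I -> R) (F : I -> T -> R) :
  (forall i, F i \in L2) -> (fun x => \sum_(i <- s) a i * F i x) \in L2.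
Proof.
move=> FL; elim: s => [|i s IHs].
  rewrite (_ : (fun _ => _) = cst 0); last by apply/funext => x; rewrite big_nil.
  exact: (@Lfun_addr_closed _ _ _ mu 2%:E (lee1n 2)).1.
rewrite (_ : (fun _ => _) =
    (fun x => a i * F i x) \+ (fun x => \sum_(i <- s) a i * F i x)).
  by apply: Lfun2D => //; exact: Lfun2Z.
by apply/funext => x; rewrite big_cons.
Qed.

(** The real-valued integral takes the default value 0 when the extended one is infinite; [innerE]
    excludes this default for functions in L2. *)
Definition inner f g : R := \int[mu]_x (f x * g x).

Lemma integrable_mul f g : f \in L2 -> g \in L2 ->
  mu.-integrable setT (EFin \o (fun x => f x * g x)).
Proof. by move=> fL gL; apply/Lfun1_integrable; exact: Lfun2_mul_Lfun1. Qed.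

Lemma innerE f g : f \in L2 -> g \in L2 ->
  (\int[mu]_x (f x * g x)%:E = (inner f g)%:E)%E.
Proof.
move=> fL gL; rewrite fineK//.
exact: integrable_fin_num (integrable_mul fL gL).
Qed.

Lemma innerC f g : inner f g = inner g f.
Proof. by apply: eq_Rintegral => x _; rewrite mulrC. Qed.

Lemma innerDl f g h : f \in L2 -> g \in L2 -> h \in L2 ->
  inner (f \+ g) h = inner f h + inner g h.
Proof.
move=> fL gL hL; rewrite /inner -RintegralD//; try exact: integrable_mul.
by apply: eq_Rintegral => x _ /=; rewrite mulrDl.
Qed.

Lemma innerZl a f g : f \in L2 -> g \in L2 ->
  inner (fun x => a * f x) g = a * inner f g.
Proof.
move=> fL gL; rewrite /inner -RintegralZl//; last exact: integrable_mul.
by apply: eq_Rintegral => x _ /=; rewrite mulrA.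
Qed.

Lemma innerBl f g h : f \in L2 -> g \in L2 -> h \in L2 ->
  inner (f \- g) h = inner f h - inner g h.
Proof.
move=> fL gL hL; rewrite /inner -RintegralB//; try exact: integrable_mul.
by apply: eq_Rintegral => x _ /=; rewrite mulrBl.
Qed.

Lemma inner_suml (I : Type) (s : seq I) (a : I -> R) (F : I -> T -> R) g :
  (forall i, F i \in L2) -> g \in L2 ->
  inner (fun x => \sum_(i <- s) a i * F i x) g = \sum_(i <- s) a i * inner (F i) g.
Proof.
move=> FL gL; elim: s => [|i s IHs].
  rewrite big_nil /inner; under eq_Rintegral do rewrite big_nil mul0r.
  by rewrite /Rintegral integral0.
rewrite big_cons -IHs -innerZl// -innerDl//; last 2 first.
- exact: Lfun2Z.
- exact: Lfun2_sum.
by apply: eq_Rintegral => x _ /=; rewrite big_cons.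
Qed.

Lemma inner_ge0 f : 0 <= inner f f.
Proof. by apply: Rintegral_ge0 => x _; rewrite -expr2 sqr_ge0. Qed.

Lemma inner_eq0 f : f \in L2 -> inner f f = 0 -> f = cst 0 %[ae mu].
Proof.
move=> fL f0; have mf := Lfun2_measurable fL.
have : (\int[mu]_x `|(f x ^+ 2)%:E| = 0)%E.
  rewrite -[RHS](congr1 EFin f0) -innerE//; apply: eq_integral => x _.
  by rewrite gee0_abs ?lee_fin ?sqr_ge0// expr2.
have mf2 : measurable_fun setT (EFin \o (fun x => f x ^+ 2) : T -> \bar R).
  by apply/measurable_EFinP; exact: measurable_funX.
move/(ae_eq_integral_abs mu measurableT mf2).
apply: filterS => x /= /(_ I)[/eqP]; rewrite sqrf_eq0 => /eqP ->.
by [].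
Qed.

Lemma inner_ae f g h k : f \in L2 -> g \in L2 -> h \in L2 -> k \in L2 ->
  f = g %[ae mu] -> h = k %[ae mu] -> inner f h = inner g k.
Proof.
move=> fL gL hL kL fg hk; rewrite /inner /Rintegral; congr fine.
apply: ae_eq_integral => //.
- apply/measurable_EFinP/measurable_funM; exact: Lfun2_measurable.
- apply/measurable_EFinP/measurable_funM; exact: Lfun2_measurable.
by apply: filterS2 fg hk => x /= fg hk xT; rewrite fg// hk.
Qed.

Lemma sqr_Lnorm2_inner f : f \in L2 ->
  ('N[mu]_2%:E[EFin \o f] ^+ 2 = (inner f f)%:E)%E.
Proof.
by move=> fL; rewrite sqr_Lnorm2 -innerE//; apply: eq_integral => x _; rewrite expr2.
Qed.

(* Completing the square: the coefficients minimising the distance to [p] are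
   its inner products with the [phi j]. *)
Lemma sqr_dist_orthonormal (m : nat) (phi : 'I_m -> T -> R) (p : T -> R)
    (b : 'I_m -> R) :
  (forall j, phi j \in L2) -> (forall i j, inner (phi i) (phi j) = (i == j)%:R) ->
  p \in L2 ->
  let q := (fun x => \sum_(j < m) b j * phi j x) \- p in
  inner q q = \sum_(j < m) (b j - inner (phi j) p) ^+ 2
    + (inner p p - \sum_(j < m) inner (phi j) p ^+ 2).
Proof.
move=> phiL on pL /=; set s := fun x => \sum_(j < m) b j * phi j x.
have sL : s \in L2 by exact: Lfun2_sum.
have sB g : g \in L2 -> inner s g = \sum_(j < m) b j * inner (phi j) g.
  by move=> gL; exact: inner_suml.
have ss : inner s s = \sum_(j < m) b j ^+ 2.
  rewrite sB//; apply: eq_bigr => i _; rewrite innerC sB// (bigD1 i)//= on eqxx.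
  rewrite big1 ?addr0 ?mulr1// => j ji.
  by rewrite on (negbTE ji) mulr0.
rewrite innerBl//; last exact: Lfun2B.
rewrite ![inner _ (s \- p)]innerC !innerBl// ss [inner p s]innerC sB//.
under [\sum_(j < m) (_ - _) ^+ 2]eq_bigr do rewrite sqrrB.
rewrite !big_split/= sumrN.
rewrite (_ : \sum_(i < m) _ *+ 2 = (\sum_(j < m) b j * inner (phi j) p) *+ 2).
  ring.
by rewrite -sumrMnl.
Qed.

End L2.

(** * Gram-Schmidt orthonormalisation modulo almost everywhere equality *)

Section gram_schmidt.
Context d (T : measurableType d) (R : realType).
Variable mu : {measure set T -> \bar R}.

Definition ae_span n (F : 'I_n -> T -> R) (g : T -> R) : Prop :=
  exists a : 'I_n -> R, g = (fun x => \sum_(k < n) a k * F k x) %[ae mu].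

Lemma ae_span_ae n (F : 'I_n -> T -> R) g h :
  g = h %[ae mu] -> ae_span F h -> ae_span F g.
Proof.
move=> gh [a ha]; exists a.
by apply: filterS2 gh ha => x /= gh ha xT; rewrite gh// ha.
Qed.

Lemma ae_span_gen n (F : 'I_n -> T -> R) k : ae_span F (F k).
Proof.
exists (fun i => (i == k)%:R); apply: nearW => x _ /=.
rewrite (bigD1 k)//= eqxx mul1r big1 ?addr0// => i /negbTE ->.
by rewrite mul0r.
Qed.

Lemma ae_spanZ n (F : 'I_n -> T -> R) c g :
  ae_span F g -> ae_span F (fun x => c * g x).
Proof.
move=> [a ha]; exists (fun k => c * a k).
apply: filterS ha => x /= /(_ I) -> _.
by rewrite mulr_sumr; apply: eq_bigr => i _; rewrite mulrA.
Qed.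

Lemma ae_spanD n (F : 'I_n -> T -> R) g h :
  ae_span F g -> ae_span F h -> ae_span F (fun x => g x + h x).
Proof.
move=> [a ha] [b hb]; exists (fun k => a k + b k).
apply: filterS2 ha hb => x /= /(_ I) -> /(_ I) -> _.
by rewrite -big_split; apply: eq_bigr => i _; rewrite /= mulrDl.
Qed.

Lemma ae_span_sum n (F : 'I_n -> T -> R) (I : Type) (s : seq I) (c : I -> R)
    (G : I -> T -> R) :
  (forall i, ae_span F (G i)) -> ae_span F (fun x => \sum_(i <- s) c i * G i x).
Proof.
move=> FG; elim: s => [|i s IHs].
  exists (fun=> 0); apply: nearW => x _ /=; rewrite big_nil big1// => i _.
  by rewrite mul0r.
under eq_fun do rewrite big_cons.
by apply: ae_spanD => //; exact: ae_spanZ.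
Qed.

Lemma ae_span_trans m n (F : 'I_m -> T -> R) (G : 'I_n -> T -> R) g :
  (forall k, ae_span F (G k)) -> ae_span G g -> ae_span F g.
Proof. by move=> FG [a /ae_span_ae]; apply; exact: ae_span_sum. Qed.

(** Induction on the family: the tail has an orthonormal basis, and the head contributes its
    residual after projection, normalised, unless that residual vanishes almost everywhere.
    Dependent families thus give [m < n]. *)
Lemma gram_schmidt n (F : 'I_n -> T -> R) :
  (forall k, F k \in Lfun mu 2%:E) ->
  exists2 m, (m <= n)%N & exists phi : 'I_m -> T -> R,
    [/\ forall j, phi j \in Lfun mu 2%:E,
        forall i j, inner mu (phi i) (phi j) = (i == j)%:R,
        forall j, ae_span F (phi j)
      & forall k, ae_span phi (F k)].
Proof.
elim: n F => [|n IHn] F FL.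
  by exists 0%N => //; exists F; split => // -[].
have [m mn [phi [phiL on Fphi phiF]]] :=
  IHn (fun k => F (lift ord0 k)) (fun k => FL _).
have {}Fphi j : ae_span F (phi j).
  by apply: ae_span_trans (Fphi j) => k; exact: ae_span_gen.
(* [s] is the orthogonal projection of the head onto the span of the tail, and [r] below is the
   residual. *)
pose s := fun x => \sum_(j < m) inner mu (F ord0) (phi j) * phi j x.
have sL : s \in Lfun mu 2%:E by exact: Lfun2_sum.
pose r := F ord0 \- s.
have rL : r \in Lfun mu 2%:E by exact: Lfun2B.
have rphi j : inner mu r (phi j) = 0.
  rewrite innerBl// inner_suml// (bigD1 j)//= on eqxx mulr1 big1 ?addr0 ?subrr//.
  by move=> i /negbTE ij; rewrite on ij mulr0.
have Fr : ae_span F r.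
  have -> : r = fun x => F ord0 x + (-1) * s x.
    by apply/funext => x; rewrite /r mulN1r.
  apply: ae_spanD; first exact: ae_span_gen.
  by apply: ae_spanZ; exact: ae_span_sum.
(* A residual of norm zero means that the head already lies in the span, so the old basis is
   kept. *)
have [r0|r0] := eqVneq (inner mu r r) 0.
  exists m; first exact: leqW.
  exists phi; split => // k; case: (unliftP ord0 k) => [i ->//|->].
  exists (fun j => inner mu (F ord0) (phi j)).
  apply: filterS (inner_eq0 rL r0) => x /= /(_ I) /eqP.
  by rewrite subr_eq0 => /eqP.
pose N := Num.sqrt (inner mu r r).
have N0 : N != 0 by rewrite sqrtr_eq0 -ltNge lt_neqAle eq_sym r0 inner_ge0.
pose e := fun x => N^-1 * r x.
have eL : e \in Lfun mu 2%:E by exact: Lfun2Z.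
have ee : inner mu e e = 1.
  rewrite innerZl// innerC innerZl// mulrA -expr2 exprVn sqr_sqrtr ?inner_ge0//.
  by rewrite mulVf.
have ephi j : inner mu e (phi j) = 0 by rewrite innerZl// rphi mulr0.
(* The new vector [e] sits at index [ord0]; the old basis is shifted to the lifted indices. *)
exists m.+1 => //; exists (fun i => oapp phi e (unlift ord0 i)); split.
- by move=> j; case: unliftP => [i|] _ /=.
- move=> i j; case: (unliftP ord0 i) => [i' ->|->];
    case: (unliftP ord0 j) => [j' ->|->];
    by rewrite ?eqxx//= innerC.
- by move=> j; case: unliftP => [i _|_] //=; exact: ae_spanZ.
have phi'phi j : ae_span (fun i => oapp phi e (unlift ord0 i)) (phi j).
  by have := ae_span_gen (fun i => oapp phi e (unlift ord0 i)) (lift ord0 j); rewrite liftK.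
have phi'e : ae_span (fun i => oapp phi e (unlift ord0 i)) e.
  by have := ae_span_gen (fun i => oapp phi e (unlift ord0 i)) ord0; rewrite unlift_none.
move=> k; case: (unliftP ord0 k) => [i ->|->]; first exact: ae_span_trans (phiF i).
have -> : F ord0 = fun x => N * e x + s x.
  by apply/funext => x; rewrite /e mulrA divff// mul1r subrK.
by apply: ae_spanD; [exact: ae_spanZ|exact: ae_span_sum].
Qed.

End gram_schmidt.

(** * Integration against product measures *)

Section tuple_integrals.
Context d (T : measurableType d) (R : realType).
Variable mu : {sigma_finite_measure set T -> \bar R}.

(** Change of variables along [cons_pair], then Tonelli with the head coordinate integrated first.
    All integrals over samples are computed by induction through this identity. *)
Lemma ge0_integral_tuple_cons n (F : n.+1.-tuple T -> \bar R) :
  measurable_fun setT F -> (forall x, 0 <= F x)%E ->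
  (\int[tuple_measure mu n.+1]_x F x =
   \int[tuple_measure mu n]_y \int[mu]_x F [tuple of x :: y])%E.
Proof.
move=> mF F0.
have F0' : {in setT, forall x, 0 <= F x}%E by move=> x _; exact: F0.
have := ge0_integral_pushforward (@measurable_cons_pair _ T n)
  (mu \x tuple_measure mu n)%E measurableT mF F0'.
rewrite preimage_setT fubini_tonelli2; last 2 first.
- by apply: measurableT_comp => //; exact: measurable_cons_pair.
- by move=> z; exact: F0.
move=> <-; apply: eq_measure_integral => //.
exact: measurable_cons_pair.
Qed.

Lemma measurable_sum_tnth n (g : T -> R) : measurable_fun setT g ->
  measurable_fun [set: n.-tuple T] (fun x => \sum_(i < n) g (tnth x i)).
Proof.
move=> mg; apply: measurable_sum => i.
by apply: measurableT_comp => //; exact: measurable_tnth.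
Qed.

Lemma measurable_prod_tnth n (g : T -> R) : measurable_fun setT g ->
  measurable_fun [set: n.-tuple T] (fun x => \prod_(i < n) g (tnth x i)).
Proof.
move=> mg; apply: measurable_prod => i _.
by apply: measurableT_comp => //; exact: measurable_tnth.
Qed.

(** Tonelli peels off one factor at a time. It serves joint densities, with [c = 1], and products of
    affinities. *)
Lemma ge0_integral_tuple_prod n (g : T -> R) (c : R) :
  measurable_fun setT g -> (forall x, 0 <= g x) ->
  (\int[mu]_x (g x)%:E = c%:E)%E ->
  (\int[tuple_measure mu n]_x (\prod_(i < n) g (tnth x i))%:E = (c ^+ n)%:E)%E.
Proof.
move=> mg g0 gc; elim: n => [|n IHn].
  rewrite /= integral_dirac// ?diracT ?mul1e ?big_ord0//.
  by apply/measurable_EFinP; exact: measurable_prod_tnth.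
rewrite ge0_integral_tuple_cons; last 2 first.
- by apply/measurable_EFinP; exact: measurable_prod_tnth.
- by move=> x; rewrite lee_fin; apply: prodr_ge0.
transitivity (\int[tuple_measure mu n]_y (c%:E * (\prod_(i < n) g (tnth y i))%:E))%E.
  apply: eq_integral => y _.
  under eq_integral => x _.
    rewrite big_ord_recl tnth0 EFinM.
    under eq_bigr do rewrite tnthS.
    over.
  rewrite ge0_integralZr ?gc//; last 3 first.
  - exact/measurable_EFinP.
  - by move=> x _; rewrite lee_fin.
  - by rewrite lee_fin; apply: prodr_ge0.
rewrite ge0_integralZl ?IHn ?exprS//.
- by apply/measurable_EFinP; exact: measurable_prod_tnth.
- by move=> x _; rewrite lee_fin; apply: prodr_ge0.
- by rewrite -gc; apply: integral_ge0 => x _; rewrite lee_fin.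
Qed.

(* The summands are centred and independent, so the cross terms vanish. *)
Lemma ge0_integral_tuple_sqr_sum n (p a : T -> R) (V : R) :
  measurable_fun setT p -> (forall x, 0 <= p x) ->
  (\int[mu]_x (p x)%:E = 1)%E ->
  measurable_fun setT a ->
  mu.-integrable setT (EFin \o (fun x => a x * p x)) ->
  \int[mu]_x (a x * p x) = 0 ->
  mu.-integrable setT (EFin \o (fun x => a x ^+ 2 * p x)) ->
  \int[mu]_x (a x ^+ 2 * p x) = V ->
  (\int[tuple_measure mu n]_x
     ((\sum_(i < n) a (tnth x i)) ^+ 2 * \prod_(i < n) p (tnth x i))%:E
   = (n%:R * V)%:E)%E.
Proof.
move=> mp p0 p1 ma iap ap0 ia2p a2pV.
have V0 : 0 <= V.
  by rewrite -a2pV; apply: Rintegral_ge0 => x _; rewrite mulr_ge0 ?sqr_ge0.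
have ip : mu.-integrable setT (EFin \o p).
  apply/integrableP; split; first exact/measurable_EFinP.
  under eq_integral do rewrite gee0_abs ?lee_fin//.
  by rewrite p1 ltry.
have prod0 k (y : k.-tuple T) : 0 <= \prod_(i < k) p (tnth y i).
  exact: prodr_ge0.
have mS k : measurable_fun [set: k.-tuple T]
    (fun x => (\sum_(i < k) a (tnth x i)) ^+ 2 * \prod_(i < k) p (tnth x i)).
  apply: measurable_funM; last exact: measurable_prod_tnth.
  by apply: measurable_funX; exact: measurable_sum_tnth.
elim: n => [|n IHn].
  rewrite /= integral_dirac// ?diracT ?mul1e ?[in LHS]big_ord0 ?expr0n/= ?mul0r//.
  by apply/measurable_EFinP; exact: mS.
rewrite ge0_integral_tuple_cons; last 2 first.
- by apply/measurable_EFinP; exact: mS.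
- by move=> x; rewrite lee_fin mulr_ge0 ?sqr_ge0.
(* Integrate out the head coordinate [x]. With [s] the sum of [a] and [q] the product of [p] over
   the tail, [(a x + s) ^+ 2] expands into three terms, whose integrals against [p] are [V], [0] and
   [s ^+ 2]. *)
transitivity (\int[tuple_measure mu n]_y
  ((V%:E * (\prod_(i < n) p (tnth y i))%:E) +
   ((\sum_(i < n) a (tnth y i)) ^+ 2 * \prod_(i < n) p (tnth y i))%:E))%E.
  apply: eq_integral => y _; set s := \sum_(i < n) _; set q := \prod_(i < n) _.
  transitivity (\int[mu]_x
    ((a x ^+ 2 * p x + (2 * s * (a x * p x) + s ^+ 2 * p x))%:E * q%:E))%E.
    apply: eq_integral => x _; rewrite !big_ord_recl !tnth0.
    under eq_bigr do rewrite tnthS.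
    under [in X in (_ * X)]eq_bigr do rewrite tnthS.
    by rewrite -/s -/q -EFinM; congr EFin; ring.
  have i1 : mu.-integrable setT (EFin \o (fun x => 2 * s * (a x * p x))).
    by have := integrableZl measurableT (2 * s) iap.
  have i2 : mu.-integrable setT (EFin \o (fun x => s ^+ 2 * p x)).
    by have := integrableZl measurableT (s ^+ 2) ip.
  have i12 : mu.-integrable setT
      (EFin \o (fun x => 2 * s * (a x * p x) + s ^+ 2 * p x)).
    by have := integrableD measurableT i1 i2.
  have i : mu.-integrable setT
     (EFin \o (fun x => a x ^+ 2 * p x + (2 * s * (a x * p x) + s ^+ 2 * p x))).
    by have := integrableD measurableT ia2p i12.
  rewrite integralZr// -[X in (X * _)%E]fineK ?(integrable_fin_num _ i)//.
  rewrite -!EFinM -!EFinD; congr EFin.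
  rewrite -mulrDl; congr (_ * _).
  rewrite -[LHS]/(\int[mu]_x (a x ^+ 2 * p x + (2 * s * (a x * p x) + s ^+ 2 * p x))).
  rewrite RintegralD// RintegralD// !RintegralZl// a2pV ap0 mulr0 add0r.
  by rewrite /Rintegral p1 mulr1.
rewrite ge0_integralD//; last 4 first.
- by move=> y _; rewrite mule_ge0// lee_fin.
- by apply: measurable_funeM; apply/measurable_EFinP; exact: measurable_prod_tnth.
- by move=> y _; rewrite lee_fin mulr_ge0 ?sqr_ge0.
- by apply/measurable_EFinP; exact: mS.
rewrite IHn ge0_integralZl//; last 2 first.
- by apply/measurable_EFinP; exact: measurable_prod_tnth.
- by move=> y _; rewrite lee_fin.
rewrite (ge0_integral_tuple_prod _ mp p0 p1) expr1n mule1 -EFinD -natr1 mulrDl mul1r.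
by rewrite addrC.
Qed.

End tuple_integrals.

(** * Upper bound *)

Section upper_bound.
Context {R : realType} {d : nat}.
Local Notation Rd := (Rspace R d).
Local Notation leb := (lebesgueR R d).
Implicit Types (p : Rd -> R) (L : R).

Lemma bounded_density_ae L p : bounded_densities L p -> {ae leb, forall x, p x <= L}.
Proof.
move=> [[mp p0 p1]]; rewrite unlock /Lnorm; case: ifPn => [mu0|]; last first.
  (* The norm is an essential supremum only on a space of positive measure; a null space carries no
     density, since every integral over it is 0. *)
  rewrite -leNgt => mu0; exfalso.
  move: p1; rewrite null_set_integral//.
  - by move/eqP; rewrite eq_sym onee_eq0.
  - by apply/measurable_EFinP; exact: measurable_funS mp.
  - by apply/eqP; rewrite eq_le mu0 measure_ge0.
move/ess_supP; apply: filterS => x /=.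
by rewrite lee_fin ger0_norm.
Qed.

(** Used twice: [g = p] shows that bounded densities lie in L2, and the square of a unit vector
    [phi] as [g] bounds its second moment under [p] by [L]. *)
Lemma integral_bounded_density_le L p (g : Rd -> R) : 0 <= L ->
  bounded_densities L p -> measurable_fun setT g -> (forall x, 0 <= g x) ->
  (\int[leb]_x (g x * p x)%:E <= L%:E * \int[leb]_x (g x)%:E)%E.
Proof.
move=> L0 pL mg g0; have pae := bounded_density_ae pL.
have [[mp p0 p1] _] := pL.
rewrite -ge0_integralZl//; last 2 first.
- exact/measurable_EFinP.
- by move=> x _; rewrite lee_fin.
apply: ae_ge0_le_integral => //.
- by move=> x _; rewrite lee_fin mulr_ge0.
- by apply/measurable_EFinP; exact: measurable_funM.
- by move=> x _; rewrite mule_ge0 ?lee_fin.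
- by apply: measurable_funeM; exact/measurable_EFinP.
apply: filterS pae => x /= pxL _.
by rewrite -EFinM lee_fin mulrC ler_wpM2r.
Qed.

Lemma bounded_density_Lfun2 L p : 0 <= L -> bounded_densities L p ->
  p \in Lfun leb 2%:E.
Proof.
move=> L0 pL; have [[mp p0 p1] _] := pL.
apply: Lfun2P => //; under eq_integral do rewrite expr2.
apply: le_lt_trans (integral_bounded_density_le L0 pL mp p0) _.
by rewrite p1 mule1 ltry.
Qed.

(** The left side is the variance of a sum of [n] independent copies of [phi(X)], and one variance
    is at most the second moment, hence at most [L]. *)
Lemma integral_sqr_dev_le n L p (phi : Rd -> R) : 0 <= L ->
  bounded_densities L p -> phi \in Lfun leb 2%:E -> inner leb phi phi = 1 ->
  (\int[tuple_measure leb n]_x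
     ((\sum_(i < n) (phi (tnth x i) - inner leb phi p)) ^+ 2
      * \prod_(i < n) p (tnth x i))%:E
   <= (n%:R * L)%:E)%E.
Proof.
move=> L0 pL phiL phi1; have [[mp p0 p1] _] := pL.
have pL2 := bounded_density_Lfun2 L0 pL.
have mphi := Lfun2_measurable phiL.
have mphi2 : measurable_fun setT (fun x => phi x ^+ 2) by exact: measurable_funX.
set t := inner leb phi p.
have ip : leb.-integrable setT (EFin \o p).
  apply/integrableP; split; first exact/measurable_EFinP.
  under eq_integral do rewrite gee0_abs ?lee_fin//.
  by rewrite p1 ltry.
have iphip := integrable_mul phiL pL2.
have phi2pL : (\int[leb]_x (phi x ^+ 2 * p x)%:E <= L%:E)%E.
  apply: le_trans (integral_bounded_density_le L0 pL mphi2 _) _.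
    by move=> x; exact: sqr_ge0.
  by under eq_integral do rewrite expr2; rewrite innerE// phi1 mule1.
have iphi2p : leb.-integrable setT (EFin \o (fun x => phi x ^+ 2 * p x)).
  apply/integrableP; split; first by apply/measurable_EFinP; exact: measurable_funM.
  rewrite (eq_integral (fun x => (phi x ^+ 2 * p x)%:E)); last first.
    by move=> x _; rewrite /= ger0_norm//; apply: mulr_ge0; [exact: sqr_ge0|exact: p0].
  exact: le_lt_trans phi2pL (ltry _).
have itp : leb.-integrable setT (EFin \o (fun x => t * p x)).
  by have := integrableZl measurableT t ip.
have i2 : leb.-integrable setT (EFin \o (fun x => 2 * t * (phi x * p x))).
  by have := integrableZl measurableT (2 * t) iphip.
have i3 : leb.-integrable setT (EFin \o (fun x => t ^+ 2 * p x)).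
  by have := integrableZl measurableT (t ^+ 2) ip.
have i12 : leb.-integrable setT
    (EFin \o (fun x => phi x ^+ 2 * p x - 2 * t * (phi x * p x))).
  by have := integrableB measurableT iphi2p i2.
have Rp1 : \int[leb]_x p x = 1 by rewrite /Rintegral p1.
have aE : (fun x => (phi x - t) * p x) = (fun x => phi x * p x - t * p x).
  by apply/funext => x; rewrite mulrBl.
have a2E : (fun x => (phi x - t) ^+ 2 * p x) =
    (fun x => phi x ^+ 2 * p x - 2 * t * (phi x * p x) + t ^+ 2 * p x).
  by apply/funext => x; ring.
rewrite (@ge0_integral_tuple_sqr_sum _ _ _ leb n p (fun x => phi x - t)
  (\int[leb]_x ((phi x - t) ^+ 2 * p x)))//.
(* After expansion the variance is the second moment minus [t ^+ 2]. *)
- rewrite lee_fin ler_wpM2l// a2E RintegralD// RintegralB// !RintegralZl// Rp1.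
  have : \int[leb]_x (phi x ^+ 2 * p x) <= L.
    by rewrite -lee_fin /Rintegral fineK ?(integrable_fin_num _ iphi2p).
  by rewrite -/(inner leb phi p) -/t; have := sqr_ge0 t; nra.
- exact: measurable_funB.
- by rewrite aE; have := integrableB measurableT iphip itp.
- by rewrite aE RintegralB// RintegralZl// Rp1 -/(inner leb phi p) -/t mulr1 subrr.
- by rewrite a2E; have := integrableD measurableT i12 i3.
Qed.

End upper_bound.

(** * Risk of the linear aggregate against the oracle error *)

Section linear_aggregate.
Context {R : realType} {d : nat}.
Local Notation Rd := (Rspace R d).
Local Notation leb := (lebesgueR R d).

Lemma sqL2E (f : Rd -> R) : sqL2 f = (\int[leb]_x (f x ^+ 2)%:E)%E.
Proof. exact: sqr_Lnorm2. Qed.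

Lemma is_estimator_linear_aggregate m (phi : 'I_m -> Rd -> R) n :
  (forall j, phi j \in Lfun leb 2%:E) -> is_estimator (linear_aggregate phi n).
Proof.
move=> phiL; have mphi j := Lfun2_measurable (phiL j).
apply: measurable_sum => j; apply: measurable_funM; last first.
  by apply: measurableT_comp => //; exact: measurable_snd.
under eq_fun do rewrite mxE.
apply: measurable_funM => //.
apply: (@measurableT_comp _ _ _ _ _ _
  (fun x : n.-tuple Rd => \sum_(i < n) phi j (tnth x i))) => //.
exact: measurable_sum_tnth.
Qed.

Section fixed_density.
Variables (L : R) (p : Rd -> R) (m : nat) (phi : 'I_m -> Rd -> R).
Hypotheses (L0 : 0 <= L) (pL : bounded_densities L p).
Hypotheses (phiL : forall j, phi j \in Lfun leb 2%:E)
  (on : forall i j, inner leb (phi i) (phi j) = (i == j)%:R).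

(** By Pythagoras this is the squared distance from [p] to the span of the orthonormal family
    [phi]. *)
Definition projection_error : R :=
  inner leb p p - \sum_(j < m) inner leb (phi j) p ^+ 2.

Lemma sqL2_mixture (b : 'rV[R]_m) :
  sqL2 (mixture phi b \- p) =
  (\sum_(j < m) (b ord0 j - inner leb (phi j) p) ^+ 2 + projection_error)%:E.
Proof.
have pL2 := bounded_density_Lfun2 L0 pL.
rewrite /sqL2 sqr_Lnorm2_inner; last by apply: Lfun2B => //; exact: Lfun2_sum.
by rewrite sqr_dist_orthonormal.
Qed.

(** Choosing the inner products with [p] as coefficients cancels the sum in [sqL2_mixture], which
    exhibits the projection error as a squared norm. *)
Lemma projection_error_ge0 : 0 <= projection_error.
Proof.
have := sqL2_mixture (\row_j inner leb (phi j) p).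
rewrite big1 => [|j _]; last by rewrite mxE subrr expr0n.
by rewrite add0r -lee_fin => <-; exact: sqre_ge0.
Qed.

(** Each mixture of [f] agrees almost everywhere with a combination of [phi], whose squared distance
    to [p] exceeds the projection error by a sum of squares. *)
Lemma oracle_error_ge M (f : 'I_M -> Rd -> R) :
  (forall k, f k \in Lfun leb 2%:E) -> (forall k, ae_span leb phi (f k)) ->
  (projection_error%:E <= oracle_error f [set: 'rV[R]_M] p)%E.
Proof.
move=> fL phif; apply: le_ereal_inf_tmp => _ [lam _ <-].
have [b lamb] : ae_span leb phi (mixture f lam) by exact: ae_span_sum.
have pL2 := bounded_density_Lfun2 L0 pL.
have mfL : mixture f lam \in Lfun leb 2%:E by exact: Lfun2_sum.
have bL : mixture phi (\row_j b j) \in Lfun leb 2%:E by exact: Lfun2_sum.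
have -> : sqL2 (mixture f lam \- p) = sqL2 (mixture phi (\row_j b j) \- p).
  rewrite /sqL2 !sqr_Lnorm2_inner ?Lfun2B//; congr EFin.
  have : mixture f lam \- p = mixture phi (\row_j b j) \- p %[ae leb].
    apply: filterS lamb => x /= /(_ I) -> _; congr (_ - _).
    by apply: eq_bigr => j _; rewrite mxE.
  by move=> h; apply: inner_ae => //; exact: Lfun2B.
by rewrite sqL2_mixture lee_fin lerDr sumr_ge0// => j _; exact: sqr_ge0.
Qed.

Lemma risk_linear_aggregate_le n : (0 < n)%N ->
  (risk (linear_aggregate phi n) p <= (projection_error + L * m%:R / n%:R)%:E)%E.
Proof.
move=> n0; have [[mp p0 p1] _] := pL.
have n0R : n%:R != 0 :> R by rewrite pnatr_eq0 -lt0n.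
have prod0 (x : n.-tuple Rd) : 0 <= \prod_(i < n) p (tnth x i).
  exact: prodr_ge0.
pose S j (x : n.-tuple Rd) :=
  (\sum_(i < n) (phi j (tnth x i) - inner leb (phi j) p)) ^+ 2
  * \prod_(i < n) p (tnth x i).
have S0 j x : 0 <= S j x by rewrite mulr_ge0 ?sqr_ge0.
have mS j : measurable_fun setT (S j).
  apply: measurable_funM; last by apply: measurable_prod_tnth.
  apply: measurable_funX.
  apply: (@measurable_sum_tnth _ _ _ _ (fun y => phi j y - inner leb (phi j) p)).
  by apply: measurable_funB => //; exact: Lfun2_measurable (phiL j).
have mprod : measurable_fun [set: n.-tuple Rd]
    (EFin \o (fun x : n.-tuple Rd => \prod_(i < n) p (tnth x i))).
  by apply/measurable_EFinP; exact: measurable_prod_tnth.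
rewrite /risk /sample_expectation.
(* Sample by sample, the error of the [j]-th coefficient is [1 / n] times a centred sum, so the loss
   splits into a variance part and the constant projection error. *)
rewrite (eq_integral (fun x => \sum_(j < m) ((n%:R ^- 2)%:E * (S j x)%:E)
    + projection_error%:E * (\prod_(i < n) p (tnth x i))%:E)%E); last first.
  move=> x _; rewrite sqL2_mixture -EFinM mulrDl EFinD EFinM; congr (_ + _)%E.
  rewrite -EFinM mulr_suml sumEFin; congr EFin; apply: eq_bigr => j _.
  rewrite mxE /S mulrA; congr (_ * _).
  rewrite sumrB sumr_const card_ord -exprVn -exprMn mulrBr; congr ((_ - _) ^+ 2).
  by rewrite -[X in _ * X]mulr_natl mulrA mulVf ?mul1r.
have K0 := projection_error_ge0.
rewrite ge0_integralD//; last 4 first.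
- by move=> x _; apply: sume_ge0 => j _; rewrite mule_ge0 ?lee_fin ?invr_ge0 ?sqr_ge0.
- apply: emeasurable_sum => j; apply: measurable_funeM; exact/measurable_EFinP.
- by move=> x _; rewrite mule_ge0 ?lee_fin.
- exact: measurable_funeM.
rewrite ge0_integralZl//; last by move=> x _; rewrite lee_fin.
rewrite (ge0_integral_tuple_prod _ mp p0 p1) expr1n mule1.
rewrite [leLHS]addeC (EFinD projection_error); apply: leeD2l.
rewrite ge0_integral_sum//; last 2 first.
- by move=> j; apply: measurable_funeM; exact/measurable_EFinP.
- by move=> j x _; rewrite mule_ge0 ?lee_fin ?invr_ge0 ?sqr_ge0.
have -> : L * m%:R / n%:R = \sum_(j < m) n%:R ^- 2 * (n%:R * L).
  rewrite sumr_const card_ord -mulr_natr; field.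
  by [].
rewrite -sumEFin; apply: lee_sum => j _.
have mSj : measurable_fun setT (EFin \o S j) by apply/measurable_EFinP; exact: mS.
rewrite (ge0_integralZl _ measurableT mSj); last 2 first.
- by move=> x _; rewrite lee_fin.
- by rewrite lee_fin invr_ge0 sqr_ge0.
rewrite EFinM; apply: lee_pmul; rewrite ?lee_fin ?invr_ge0 ?sqr_ge0//.
  by apply: integral_ge0 => x _; rewrite lee_fin.
apply: integral_sqr_dev_le => //.
by rewrite on eqxx.
Qed.

End fixed_density.

(** The projection error appears in both the risk bound and the oracle bound and cancels, leaving
    [L * m / n] with [m <= M]. *)
Lemma max_excess_risk_linear_aggregate_le (L : R) M (f : 'I_M -> Rd -> R)
    m (phi : 'I_m -> Rd -> R) n :
  0 <= L -> (m <= M)%N -> (forall k, f k \in Lfun leb 2%:E) ->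
  orthonormal_basis_of_span f phi -> (0 < n)%N ->
  (max_excess_risk (bounded_densities L) [set: 'rV[R]_M] f (linear_aggregate phi n)
   <= (L * M%:R / n%:R)%:E)%E.
Proof.
move=> L0 mM fL [phiL on _ phif] n0; apply: ge_ereal_sup => _ [p pL <-].
have on' i j : inner leb (phi i) (phi j) = (i == j)%:R by rewrite /inner /Rintegral on.
have phif' k : ae_span leb phi (f k).
  have [b fb] := phif k; exists (fun j => b ord0 j).
  exact: fb.
apply: le_trans (leeB (risk_linear_aggregate_le L0 pL phiL on' n0)
  (oracle_error_ge L0 pL phiL on' fL phif')) _.
rewrite -EFinB lee_fin addrAC subrr add0r ler_wpM2r ?invr_ge0//.
by rewrite ler_wpM2l// ler_nat.
Qed.

Lemma orthonormal_basis_exists M (f : 'I_M -> Rd -> R) :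
  (forall k, f k \in Lfun leb 2%:E) ->
  exists m : nat, (m <= M)%N /\
    exists phi : 'I_m -> Rd -> R, orthonormal_basis_of_span f phi.
Proof.
move=> fL; have [m mM [phi [phiL on fphi phif]]] := gram_schmidt fL.
exists m; split=> //; exists phi; split=> //.
- by move=> i j; rewrite innerE// on.
- move=> j; have [a ha] := fphi j; exists (\row_k a k).
  apply: filterS ha => x /= /(_ I) -> _.
  by apply: eq_bigr => k _; rewrite mxE.
- move=> k; have [b hb] := phif k; exists (\row_j b j).
  apply: filterS hb => x /= /(_ I) -> _.
  by apply: eq_bigr => j _; rewrite mxE.
Qed.

End linear_aggregate.

(** * Lower bound *)

Section lower_bound_tools.
Context d (T : measurableType d) (R : realType).
Variable mu : {sigma_finite_measure set T -> \bar R}.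

Lemma bernoulli_ineq (x : R) n : 0 <= x -> x <= 1 -> 1 - n%:R * x <= (1 - x) ^+ n.
Proof.
move=> x0 x1; elim: n => [|n IHn]; first by rewrite mul0r subr0 expr0.
rewrite exprS -natr1; apply: le_trans (ler_wpM2l _ IHn); last by rewrite subr_ge0.
have := mulr_ge0 (ler0n R n) (sqr_ge0 x); nra.
Qed.

(** Pointwise form of the passage from affinity to overlap. The weight 1/16 makes the correction
    cost only 1/8 once [a] and [b] are integrated as probability densities. *)
Lemma minr_ge_affinity (a b g : R) : 0 <= a -> 0 <= b -> g ^+ 2 <= a * b ->
  g / 2 <= Num.min a b + (a + b) / 16.
Proof.
wlog ab : a b / a <= b.
  move=> H a0 b0 gab; case: (leP a b) => [ab|/ltW ba].
    by have := H _ _ ab a0 b0 gab; rewrite min_l.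
  by have := H _ _ ba b0 a0; rewrite min_l// (addrC b a) mulrC; apply.
move=> a0 b0 gab; rewrite min_l//.
have h0 : 0 <= a + (a + b) / 16 by lra.
case: (leP g 0) => [g0|/ltW g0]; first lra.
rewrite -ler_sqr ?nnegrE//; last lra.
(* The right side is [(17 * a + b) / 16], and [(17 * a + b) ^+ 2 >= 68 * a * b >= 64 * g ^+ 2]. *)
have := sqr_ge0 (17 * a - b); nra.
Qed.

(** No [t] is close to both [u] and [v]: by the parallelogram identity the two squared distances add
    up to at least [(u - v) ^+ 2 / 2]. Both weights are then lowered to their minimum. *)
Lemma sqr_dist_two_points (t u v a b : R) : 0 <= a -> 0 <= b ->
  (u - v) ^+ 2 / 2 * Num.min a b <= (t - u) ^+ 2 * a + (t - v) ^+ 2 * b.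
Proof.
move=> a0 b0; apply: (@le_trans _ _ (((t - u) ^+ 2 + (t - v) ^+ 2) * Num.min a b)).
  apply: ler_wpM2r; first by rewrite le_min a0.
  have := sqr_ge0 (t - u + (t - v)); nra.
rewrite mulrDl; apply: lerD; apply: ler_wpM2l; rewrite ?sqr_ge0//.
  by rewrite ge_min lexx.
by rewrite ge_min lexx orbT.
Qed.

(* [g] bounds the Hellinger affinity of [p] and [q] from below; unlike the total
   variation distance, affinities multiply under products. *)
Lemma integral_min_tuple_ge n (p q g : T -> R) (c : R) :
  measurable_fun setT p -> (forall x, 0 <= p x) -> (\int[mu]_x (p x)%:E = 1)%E ->
  measurable_fun setT q -> (forall x, 0 <= q x) -> (\int[mu]_x (q x)%:E = 1)%E ->
  measurable_fun setT g -> (forall x, 0 <= g x) -> (\int[mu]_x (g x)%:E = c%:E)%E ->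
  (forall x, g x ^+ 2 <= p x * q x) ->
  ((c ^+ n / 2 - 1 / 8)%:E <=
   \int[tuple_measure mu n]_x
     (Num.min (\prod_(i < n) p (tnth x i)) (\prod_(i < n) q (tnth x i)))%:E)%E.
Proof.
move=> mp p0 p1 mq q0 q1 mg g0 gc gpq.
pose P (x : n.-tuple T) := \prod_(i < n) p (tnth x i).
pose Q (x : n.-tuple T) := \prod_(i < n) q (tnth x i).
pose G (x : n.-tuple T) := \prod_(i < n) g (tnth x i).
have mP : measurable_fun setT P by exact: measurable_prod_tnth.
have mQ : measurable_fun setT Q by exact: measurable_prod_tnth.
have mG : measurable_fun setT G by exact: measurable_prod_tnth.
have iP : (\int[tuple_measure mu n]_x (P x)%:E = (1 ^+ n)%:E)%E.
  exact: ge0_integral_tuple_prod.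
have iQ : (\int[tuple_measure mu n]_x (Q x)%:E = (1 ^+ n)%:E)%E.
  exact: ge0_integral_tuple_prod.
have iG : (\int[tuple_measure mu n]_x (G x)%:E = (c ^+ n)%:E)%E.
  exact: ge0_integral_tuple_prod.
have P0 x : 0 <= P x by exact: prodr_ge0.
have Q0 x : 0 <= Q x by exact: prodr_ge0.
have G0 x : 0 <= G x by exact: prodr_ge0.
have GPQ x : G x ^+ 2 <= P x * Q x.
  rewrite /G /P /Q -big_split -prodrXl; apply: ler_prod => i _.
  by rewrite sqr_ge0 gpq.
rewrite -[leRHS]/(\int[tuple_measure mu n]_x (Num.min (P x) (Q x))%:E)%E.
rewrite EFinB leeBlDr//.
have mmin : measurable_fun setT (fun x => Num.min (P x) (Q x)).
  exact: measurable_minr.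
(* Both joint densities have mass 1, so the correction term integrates to 2/16. *)
have -> : ((1 / 8)%:E =
    \int[tuple_measure mu n]_x ((16^-1)%:E * ((P x)%:E + (Q x)%:E)))%E.
  rewrite ge0_integralZl//; last 2 first.
  - by apply: emeasurable_funD; exact/measurable_EFinP.
  - by move=> x _; rewrite adde_ge0 ?lee_fin.
  rewrite ge0_integralD//; last 4 first.
  - by move=> x _; rewrite lee_fin.
  - exact/measurable_EFinP.
  - by move=> x _; rewrite lee_fin.
  - exact/measurable_EFinP.
  rewrite iP iQ expr1n -EFinD -EFinM; congr EFin; by field.
rewrite -ge0_integralD//; last 4 first.
- by move=> x _; rewrite lee_fin le_min P0 Q0.
- exact/measurable_EFinP.
- by move=> x _; rewrite mule_ge0 ?adde_ge0 ?lee_fin.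
- by apply: measurable_funeM; apply: emeasurable_funD; exact/measurable_EFinP.
have -> : ((c ^+ n / 2)%:E = \int[tuple_measure mu n]_x ((2^-1)%:E * (G x)%:E))%E.
  rewrite ge0_integralZl//; last 2 first.
  - exact/measurable_EFinP.
  - by move=> x _; rewrite lee_fin.
  by rewrite iG -EFinM mulrC.
apply: ge0_le_integral => //.
- by move=> x _; rewrite mule_ge0 ?lee_fin.
- by apply: measurable_funeM; exact/measurable_EFinP.
- apply: emeasurable_funD; first exact/measurable_EFinP.
  by apply: measurable_funeM; apply: emeasurable_funD; exact/measurable_EFinP.
move=> x _.
rewrite -[leLHS]/((2^-1 * G x)%:E)
  -[leRHS]/((Num.min (P x) (Q x) + 16^-1 * (P x + Q x))%:E).
rewrite lee_fin mulrC [16^-1 * _]mulrC.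
exact: minr_ge_affinity.
Qed.

End lower_bound_tools.

(** * Step functions on disjoint cells of equal measure *)

Section step_functions.
Context d (T : measurableType d) (R : realType).
Variables (mu : {measure set T -> \bar R}) (I : finType) (C : I -> set T) (w : R).
Hypotheses (mC : forall z, measurable (C z))
  (trivC : forall z z' y, C z y -> C z' y -> z = z')
  (muC : forall z, mu (C z) = w%:E).

Definition step (c : I -> R) (y : T) : R := \sum_z c z * \1_(C z) y.

Lemma step_in c z y : C z y -> step c y = c z.
Proof.
move=> Czy; rewrite /step (bigD1 z)//= indicE mem_set// mulr1 big1 ?addr0// => z' z'z.
rewrite indicE memNset ?mulr0// => Cz'y.
by move: z'z; rewrite (trivC Cz'y Czy) eqxx.
Qed.

Lemma step_out c y : (forall z, ~ C z y) -> step c y = 0.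
Proof.
by move=> Cy; rewrite /step big1// => z _; rewrite indicE memNset ?mulr0.
Qed.

Lemma stepP y : (exists z, C z y) \/ (forall z, ~ C z y).
Proof.
by case: (pselect (exists z, C z y)) => [|/forallNP]; [left|right].
Qed.

Lemma step_ge0 c y : (forall z, 0 <= c z) -> 0 <= step c y.
Proof. by move=> c0; apply: sumr_ge0 => z _; rewrite mulr_ge0. Qed.

Lemma measurable_step c : measurable_fun setT (step c).
Proof. by apply: measurable_sum => z; apply: measurable_funM. Qed.

(** Reduces membership of a step function in a span of step functions to an identity between
    coefficients. *)
Lemma step_sum (J : Type) (s : seq J) (a : J -> R) (c : J -> I -> R) y :
  \sum_(j <- s) a j * step (c j) y = step (fun z => \sum_(j <- s) a j * c j z) y.
Proof.
rewrite /step; under eq_bigr do rewrite mulr_sumr.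
rewrite exchange_big; apply: eq_bigr => z _ /=.
by rewrite mulr_suml; apply: eq_bigr => j _; rewrite mulrA.
Qed.

Lemma integral_step c : (forall z, 0 <= c z) ->
  (\int[mu]_y (step c y)%:E = (w * \sum_z c z)%:E)%E.
Proof.
move=> c0; under eq_integral do rewrite -sumEFin.
rewrite ge0_integral_sum//; last 2 first.
- by move=> z; apply/measurable_EFinP; exact: measurable_funM.
- by move=> z y _; rewrite lee_fin mulr_ge0.
rewrite mulr_sumr -sumEFin; apply: eq_bigr => z _.
under eq_integral do rewrite EFinM.
rewrite ge0_integralZl//; last 2 first.
- exact/measurable_EFinP.
- by rewrite lee_fin.
by rewrite integral_indic// setIT muC -EFinM mulrC.
Qed.

Lemma step_Lfun2 c : step c \in Lfun mu 2%:E.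
Proof.
apply: Lfun2P; first exact: measurable_step.
(* The cells are disjoint, so squaring the function squares its coefficients. *)
rewrite (eq_integral (fun y => (step (fun z => c z ^+ 2) y)%:E)).
  by rewrite integral_step ?ltry// => z; exact: sqr_ge0.
move=> y _; congr EFin; case: (stepP y) => [[z Cz]|Cy].
  by rewrite !(step_in _ Cz).
by rewrite !(step_out _ Cy) expr0n.
Qed.

End step_functions.

(** * Assouad's hypercube of perturbed uniform densities *)

Section hypercube.
Context {R : realType} {d : nat}.
Local Notation Rd := (Rspace R d).
Local Notation leb := (lebesgueR R d).

Lemma integral_prod_separable d1 d2 (T1 : measurableType d1) (T2 : measurableType d2)
    (m1 : {sigma_finite_measure set T1 -> \bar R})
    (m2 : {sigma_finite_measure set T2 -> \bar R}) (a : T1 -> R) (b : T2 -> R) (B : R) :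
  measurable_fun setT a -> (forall x, 0 <= a x) ->
  measurable_fun setT b -> (forall y, 0 <= b y) -> (\int[m2]_y (b y)%:E = B%:E)%E ->
  (\int[m1 \x m2]_z (b z.2 * a z.1)%:E = B%:E * \int[m1]_x (a x)%:E)%E.
Proof.
move=> ma a0 mb b0 bB.
have ma' : measurable_fun setT (fun z : T1 * T2 => a z.1).
  exact: measurableT_comp.
have mb' : measurable_fun setT (fun z : T1 * T2 => b z.2).
  exact: measurableT_comp.
rewrite fubini_tonelli1; last 2 first.
- by apply/measurable_EFinP; exact: measurable_funM.
- by move=> z; rewrite lee_fin mulr_ge0.
rewrite -ge0_integralZl//; last 3 first.
- exact/measurable_EFinP.
- by move=> x _; rewrite lee_fin.
- by rewrite -bB; apply: integral_ge0 => y _; rewrite lee_fin.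
apply: eq_integral => x _; rewrite /fubini_F /=.
under eq_integral do rewrite EFinM.
rewrite ge0_integralZr ?bB//.
- exact/measurable_EFinP.
- by move=> y _; rewrite lee_fin.
- by rewrite lee_fin.
Qed.

(** Tonelli, by joint measurability of the estimator. As one integral over sample and point, the
    risk can be bounded pointwise before integrating. *)
Lemma risk_prod n (T : estimator n) (p : Rd -> R) :
  is_estimator T -> measurable_fun setT p -> (forall x, 0 <= p x) ->
  (risk T p = \int[tuple_measure leb n \x leb]_z
    ((T z.1 z.2 - p z.2) ^+ 2 * \prod_(i < n) p (tnth z.1 i))%:E)%E.
Proof.
move=> mT mp p0.
have mD : measurable_fun setT (fun z : n.-tuple Rd * Rd => T z.1 z.2 - p z.2).
  by apply: measurable_funB => //; exact: measurableT_comp.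
rewrite fubini_tonelli1; last 2 first.
- apply/measurable_EFinP; apply: measurable_funM; first exact: measurable_funX.
  apply: (@measurableT_comp _ _ _ _ _ _
    (fun x : n.-tuple Rd => \prod_(i < n) p (tnth x i))) => //.
  exact: measurable_prod_tnth.
- by move=> z; rewrite lee_fin mulr_ge0 ?sqr_ge0 ?prodr_ge0.
apply: eq_integral => x _; rewrite sqL2E /fubini_F /=.
under [RHS]eq_integral do rewrite EFinM.
rewrite ge0_integralZr//.
- apply/measurable_EFinP; apply: measurable_funX.
  exact: (measurableT_comp mD (measurable_pair1 x)).
- by move=> y _; rewrite lee_fin sqr_ge0.
- by rewrite lee_fin prodr_ge0.
Qed.

Variables (L h : R) (m : nat) (C : 'I_m * bool -> set Rd).
Hypotheses (L0 : 0 < L) (m0 : (0 < m)%N) (h0 : 0 <= h) (h1 : h <= 1).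
Hypotheses (mC : forall z, measurable (C z))
  (trivC : forall z z' y, C z y -> C z' y -> z = z')
  (muC : forall z, leb (C z) = ((L * m%:R)^-1)%:E).

Definition pm1 (b : bool) : R := if b then 1 else -1.

(** An index [z] is a pair of a bin and one of its halves. The [2 * m] cells have total measure
    [2 / L], so the mean height [L / 2] gives mass 1, and [h <= 1] keeps the values between 0 and
    [L]. *)
Definition cube_density (om : {ffun 'I_m -> bool}) : Rd -> R :=
  step C (fun z => L / 2 * (1 + h * (pm1 (om z.1) * pm1 z.2))).

Definition flip (j : 'I_m) (om : {ffun 'I_m -> bool}) : {ffun 'I_m -> bool} :=
  [ffun k => om k (+) (k == j)].

Lemma flipK j : involutive (flip j).
Proof. by move=> om; apply/ffunP => k; rewrite !ffunE addbK. Qed.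

Lemma cube_coef_ge0 b c : 0 <= L / 2 * (1 + h * (pm1 b * pm1 c)).
Proof.
apply: mulr_ge0; first by rewrite divr_ge0// ltW.
by move: (h0) (h1); rewrite /pm1; case: b; case: c; lra.
Qed.

Lemma cube_density_ge0 om y : 0 <= cube_density om y.
Proof. by apply: step_ge0 => z; exact: cube_coef_ge0. Qed.

Lemma measurable_cube_density om : measurable_fun setT (cube_density om).
Proof. exact: measurable_step. Qed.

Lemma Lm_neq0 : L * m%:R != 0.
Proof. by rewrite mulf_neq0 ?gt_eqF// ltr0n. Qed.

Lemma integral_cube_density om : (\int[leb]_y (cube_density om y)%:E = 1)%E.
Proof.
rewrite (integral_step mC muC); last by move=> z; exact: cube_coef_ge0.
congr EFin; rewrite -(pair_bigA _ (fun j b => L / 2 * (1 + h * (pm1 (om j) * pm1 b))))/=.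
(* The perturbations of the two halves of a bin cancel, whatever its sign. *)
rewrite (eq_bigr (fun=> L)); last by move=> j _; rewrite big_bool /pm1 /=; field.
by rewrite sumr_const card_ord -[X in _ * X]mulr_natr mulVf// Lm_neq0.
Qed.

Lemma cube_density_bounded om : bounded_densities L (cube_density om).
Proof.
split.
  split; [exact: measurable_cube_density|exact: cube_density_ge0|].
  exact: integral_cube_density.
rewrite unlock /Lnorm; case: ifPn => _; last by rewrite lee_fin ltW.
apply/ess_supP/nearW => y /=; rewrite lee_fin ger0_norm ?cube_density_ge0//.
case: (stepP C y) => [[z Cz]|Cy].
  rewrite /cube_density (step_in trivC _ Cz).
  by move: (L0) (h0) (h1); case: (om z.1); case: (z.2); rewrite /pm1 /=; nra.
by rewrite /cube_density (step_out _ Cy) ltW.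
Qed.

(* On the flipped bin the exact affinity would be [L / 2 * sqrt (1 - h ^+ 2)];
   the smaller value [L / 2 * (1 - h ^+ 2)] is sufficient. *)
Definition cube_affinity (om : {ffun 'I_m -> bool}) (j : 'I_m) : Rd -> R :=
  step C (fun z => if z.1 == j then L / 2 * (1 - h ^+ 2)
                   else L / 2 * (1 + h * (pm1 (om z.1) * pm1 z.2))).

Lemma cube_affinity_coef_ge0 (om : {ffun 'I_m -> bool}) (j : 'I_m) (z : 'I_m * bool) :
  0 <= (if z.1 == j then L / 2 * (1 - h ^+ 2)
        else L / 2 * (1 + h * (pm1 (om z.1) * pm1 z.2))).
Proof.
case: ifPn => _; last exact: cube_coef_ge0.
by apply: mulr_ge0; [rewrite divr_ge0// ltW|rewrite subr_ge0 expr_le1].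
Qed.

Lemma integral_cube_affinity om j :
  (\int[leb]_y (cube_affinity om j y)%:E = (1 - h ^+ 2 / m%:R)%:E)%E.
Proof.
rewrite (integral_step mC muC); last by move=> z; exact: cube_affinity_coef_ge0.
congr EFin; rewrite -(pair_bigA _ (fun (k : 'I_m) (b : bool) =>
  if k == j then L / 2 * (1 - h ^+ 2)
  else L / 2 * (1 + h * (pm1 (om k) * pm1 b))))/=.
(* Only the two halves of bin [j] lose mass, each [L / 2 * h ^+ 2] in height. *)
rewrite (eq_bigr (fun k => L - L * h ^+ 2 * (k == j)%:R)); last first.
  by move=> k _; rewrite big_bool /pm1 /=; case: (k == j); case: (om k) => /=; field.
rewrite sumrB sumr_const card_ord -mulr_sumr (bigD1 j)//= eqxx big1 ?addr0; last first.
  by move=> k /negbTE ->.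
rewrite -[L *+ m]mulr_natr /= mulr1; field.
by rewrite gt_eqF ?ltr0n// gt_eqF.
Qed.

(** Off bin [j] the two densities coincide. On it their product is [(L / 2) ^+ 2 * (1 - h ^+ 2)],
    and [1 - h ^+ 2] dominates its own square because it lies in the unit interval. *)
Lemma cube_affinity_sqr_le om j y :
  cube_affinity om j y ^+ 2 <= cube_density om y * cube_density (flip j om) y.
Proof.
rewrite /cube_affinity /cube_density.
case: (stepP C y) => [[z Cz]|Cy]; last by rewrite !(step_out _ Cy) mul0r expr0n.
rewrite !(step_in trivC _ Cz) ffunE; case: (z.1 == j); last by rewrite addbF expr2.
have hh : h ^+ 2 <= 1 by rewrite expr_le1.
have hh0 := sqr_ge0 h; have L2 := sqr_ge0 L.
have : 0 <= L ^+ 2 * ((1 - h ^+ 2) * h ^+ 2).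
  by apply: mulr_ge0 => //; apply: mulr_ge0 => //; rewrite subr_ge0.
by case: (om z.1); case: (z.2); rewrite /pm1 /=; nra.
Qed.

Definition cube_bin (j : 'I_m) : Rd -> R := step C (fun z => (z.1 == j)%:R).

Lemma integral_cube_bin j :
  (\int[leb]_y (cube_bin j y)%:E = (2 / (L * m%:R))%:E)%E.
Proof.
rewrite (integral_step mC muC)//.
congr EFin; rewrite -(pair_bigA _ (fun (k : 'I_m) (b : bool) => (k == j)%:R))/=.
under eq_bigr do rewrite big_bool.
rewrite (bigD1 j)//= eqxx big1 ?addr0 1?mulrC// => k /negbTE ->.
by rewrite addr0.
Qed.

(* Assouad's argument: pairing each vertex [om] with [flip j om] on the bin [j]. *)
Lemma cube_loss_ge (t : R) y (q : {ffun 'I_m -> bool} -> R) :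
  (forall om, 0 <= q om) ->
  \sum_j \sum_om cube_bin j y * ((L * h) ^+ 2 / 4 * Num.min (q om) (q (flip j om)))
  <= \sum_om (t - cube_density om y) ^+ 2 * q om.
Proof.
move=> q0; case: (stepP C y) => [[z Cz]|Cy]; last first.
  rewrite big1; first by apply: sumr_ge0 => om _; rewrite mulr_ge0 ?sqr_ge0.
  by move=> j _; apply: big1 => om _; rewrite /cube_bin (step_out _ Cy) mul0r.
(* Only the bin containing [y] contributes to the left side. *)
rewrite (bigD1 z.1)//= [X in _ + X]big1 ?addr0; last first.
  move=> j jz; apply: big1 => om _.
  by rewrite /cube_bin (step_in trivC _ Cz) eq_sym (negbTE jz) mul0r.
set k := z.1; set F := fun om => (t - cube_density om y) ^+ 2 * q om.
(* [flip k] is an involution of the vertices, so the sum is unchanged when each term is averaged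
   with that of its flipped vertex. *)
have -> : \sum_om (t - cube_density om y) ^+ 2 * q om
    = \sum_om (F om + F (flip k om)) / 2.
  rewrite -mulr_suml big_split/= [X in _ + X](_ : _ = \sum_om F om); last first.
    by rewrite [RHS](reindex_inj (inv_inj (flipK k))).
  by rewrite -/F; field.
apply: ler_sum => om _.
have := sqr_dist_two_points t (cube_density om y) (cube_density (flip k om) y)
  (q0 om) (q0 (flip k om)).
have -> : (cube_density om y - cube_density (flip k om) y) ^+ 2 = (L * h) ^+ 2.
  rewrite /cube_density !(step_in trivC _ Cz) ffunE eqxx addbT.
  by case: (om z.1); case: (z.2); rewrite /pm1 /=; field.
rewrite /cube_bin (step_in trivC _ Cz) eqxx mul1r /F.
by lra.
Qed.

(** Each bin has measure [2 / (L * m)], and for each of its pairs the overlap of the sample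
    densities is at least 1/4. The average risk is therefore at least [m * (2 / (L * m)) * ((L * h)
    ^+ 2 / 4) * (1 / 4) = L * h ^+ 2 / 8]. *)
Lemma sum_risk_cube_ge n (T : estimator n) : is_estimator T ->
  n%:R * (h ^+ 2 / m%:R) <= 4^-1 ->
  ((#|{ffun 'I_m -> bool}|%:R * (L * h ^+ 2 / 8))%:E
   <= \sum_om risk T (cube_density om))%E.
Proof.
move=> mT hn.
pose q om (x : n.-tuple Rd) := \prod_(i < n) cube_density om (tnth x i).
have q0 om x : 0 <= q om x by apply: prodr_ge0 => i _; exact: cube_density_ge0.
have mq om : measurable_fun setT (q om).
  by apply: measurable_prod_tnth; exact: measurable_cube_density.
pose a j om (x : n.-tuple Rd) := (L * h) ^+ 2 / 4 * Num.min (q om x) (q (flip j om) x).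
have a0 j om x : 0 <= a j om x.
  by rewrite mulr_ge0 ?divr_ge0 ?sqr_ge0// le_min !q0.
have ma j om : measurable_fun setT (a j om).
  by apply: measurable_funM => //; exact: measurable_minr.
have mbin j : measurable_fun setT (cube_bin j) by exact: measurable_step.
have bin0 j y : 0 <= cube_bin j y by exact: step_ge0.
have mab j om : measurable_fun setT
    (fun z : n.-tuple Rd * Rd => cube_bin j z.2 * a j om z.1).
  by apply: measurable_funM; exact: measurableT_comp.
have mloss om : measurable_fun setT
    (fun z : n.-tuple Rd * Rd => (T z.1 z.2 - cube_density om z.2) ^+ 2 * q om z.1).
  apply: measurable_funM; last exact: measurableT_comp.
  apply: measurable_funX; apply: measurable_funB => //.
  by apply: measurableT_comp => //; exact: measurable_cube_density.
have -> : (\sum_om risk T (cube_density om) =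
    \int[tuple_measure leb n \x leb]_z
      (\sum_om (T z.1 z.2 - cube_density om z.2) ^+ 2 * q om z.1)%:E)%E.
  under [RHS]eq_integral do rewrite -sumEFin.
  rewrite ge0_integral_sum//; last 2 first.
  - by move=> om; exact/measurable_EFinP.
  - by move=> om z _; rewrite lee_fin mulr_ge0 ?sqr_ge0.
  apply: eq_bigr => om _; apply: risk_prod => //.
    exact: measurable_cube_density.
  exact: cube_density_ge0.
(* Apply the pointwise bound [cube_loss_ge] at each sample and point; the bound then separates into
   a factor in the point and a factor in the sample. *)
apply: (@le_trans _ _ (\int[tuple_measure leb n \x leb]_z
    (\sum_j \sum_om cube_bin j z.2 * a j om z.1)%:E)%E); last first.
  apply: ge0_le_integral => //.
  - move=> z _; rewrite lee_fin; apply: sumr_ge0 => j _; apply: sumr_ge0 => om _.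
    by rewrite mulr_ge0.
  - apply/measurable_EFinP; apply: measurable_sum => j; exact: measurable_sum.
  - by apply/measurable_EFinP; exact: measurable_sum.
  by move=> z _; rewrite lee_fin; exact: (cube_loss_ge _ _ (fun om => q0 om z.1)).
have -> : (\int[tuple_measure leb n \x leb]_z
      (\sum_j \sum_om cube_bin j z.2 * a j om z.1)%:E =
    \sum_j \sum_om ((2 / (L * m%:R))%:E * \int[tuple_measure leb n]_x (a j om x)%:E))%E.
  under eq_integral do rewrite -sumEFin.
  rewrite ge0_integral_sum//; last 2 first.
  - by move=> j; apply/measurable_EFinP; exact: measurable_sum.
  - move=> j z _; rewrite lee_fin; apply: sumr_ge0 => om _.
    by rewrite mulr_ge0.
  apply: eq_bigr => j _; under eq_integral do rewrite -sumEFin.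
  rewrite ge0_integral_sum//; last 2 first.
  - by move=> om; exact/measurable_EFinP.
  - by move=> om z _; rewrite lee_fin mulr_ge0.
  apply: eq_bigr => om _; apply: integral_prod_separable => //.
  exact: integral_cube_bin.
have -> : #|{ffun 'I_m -> bool}|%:R * (L * h ^+ 2 / 8) =
    \sum_(j < m) \sum_(om : {ffun 'I_m -> bool})
      2 / (L * m%:R) * ((L * h) ^+ 2 / 4 * 4^-1).
  have sumE N (x : R) : x *+ N *+ m = N%:R * m%:R * x.
    by rewrite -[LHS]mulr_natl -[x *+ N]mulr_natl mulrA [m%:R * _]mulrC.
  rewrite !sumr_const card_ord sumE; move: #|_|%:R => N; field.
  by rewrite gt_eqF ?ltr0n// gt_eqF.
rewrite -sumEFin; apply: lee_sum => j _; rewrite -sumEFin; apply: lee_sum => om _.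
have c0 : 0 <= 2 / (L * m%:R) by rewrite divr_ge0// mulr_ge0// ltW.
rewrite EFinM; apply: lee_pmul; rewrite ?lee_fin//.
  by rewrite mulr_ge0 ?divr_ge0 ?sqr_ge0.
have mmin : measurable_fun setT (fun x => Num.min (q om x) (q (flip j om) x)).
  exact: measurable_minr.
rewrite [leRHS](_ : _ = ((L * h) ^+ 2 / 4)%:E * \int[tuple_measure leb n]_x
    (Num.min (q om x) (q (flip j om) x))%:E)%E; last first.
  rewrite -ge0_integralZl//.
  - exact/measurable_EFinP.
  - by move=> x _; rewrite lee_fin le_min !q0.
  - by rewrite lee_fin divr_ge0 ?sqr_ge0.
rewrite EFinM; apply: lee_pmul; rewrite ?lee_fin ?divr_ge0 ?sqr_ge0//.
have := integral_min_tuple_ge n (measurable_cube_density om) (cube_density_ge0 om)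
  (integral_cube_density om) (measurable_cube_density (flip j om))
  (cube_density_ge0 (flip j om)) (integral_cube_density (flip j om))
  (measurable_step mC _) (fun y => step_ge0 C y (cube_affinity_coef_ge0 om j))
  (integral_cube_affinity om j) (cube_affinity_sqr_le om j).
apply: le_trans; rewrite lee_fin.
have hm0 : 0 <= h ^+ 2 / m%:R by rewrite divr_ge0 ?sqr_ge0.
have hm1 : h ^+ 2 / m%:R <= 1.
  rewrite ler_pdivrMr ?ltr0n// mul1r (@le_trans _ _ 1)// ?expr_le1//.
  by rewrite ler1n.
(* The [n]-th power of the affinity is at least [1 - n * (h ^+ 2 / m) >= 3/4], and
   [3/8 - 1/8 = 1/4]. *)
have := bernoulli_ineq n hm0 hm1; lra.
Qed.

End hypercube.

(** * Construction of the least favourable functions and choice of the perturbation size *)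

Section lower_bound.
Context {R : realType} {d : nat}.
Local Notation Rd := (Rspace R d).
Local Notation leb := (lebesgueR R d).

(** The cells are consecutive slabs: intervals of length [w] in the first coordinate, which exists
    because [d] is positive, times the unit interval in every other coordinate. *)
Lemma disjoint_cells (w : R) : (0 < d)%N -> 0 < w ->
  exists cell : nat -> set Rd,
    [/\ forall k, measurable (cell k),
        forall k l y, cell k y -> cell l y -> k = l
      & forall k, leb (cell k) = w%:E].
Proof.
move=> d0 w0; pose i0 := Ordinal d0.
pose A k (i : 'I_d) : set (measurableTypeR R) :=
  if i == i0 then `[k%:R * w, k.+1%:R * w[%classic else `[0, 1[%classic.
have mA k i : measurable (A k i) by rewrite /A; case: ifP.
exists (fun k => [set y | forall i, A k i (tnth y i)]); split.
- move=> k; rewrite (_ : mkset _ =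
      \bigcap_(i : 'I_d) ((fun y : Rd => tnth y i) @^-1` A k i)).
    apply: fin_bigcap_measurable => // i _; rewrite -[X in measurable X]setTI.
    by apply: measurable_tnth.
  by apply/seteqP; split=> y /= Ay i; move=> *; apply: Ay.
- move=> k l y /(_ i0) + /(_ i0); rewrite /A eqxx /= !in_itv /=.
  move=> /andP[ky yk] /andP[ly yl].
  have kl : (k < l.+1)%N by rewrite -(ltr_nat R) -(ltr_pM2r w0) (le_lt_trans ky).
  have lk : (l < k.+1)%N by rewrite -(ltr_nat R) -(ltr_pM2r w0) (le_lt_trans ly).
  by apply/eqP; rewrite eqn_leq -ltnS kl -ltnS lk.
move=> k; rewrite [LHS]tuple_measure_rect// (bigD1 i0)//= big1 ?mule1.
  rewrite /A eqxx lebesgue_measure_itv/= lte_fin ltr_pM2r// ltr_nat ltnSn.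
  by rewrite -EFinB -mulrBl -natrB// subSnn mul1r.
move=> i /negbTE ii0.
by rewrite /A ii0 lebesgue_measure_itv/= lte_fin ltr01 sube0.
Qed.

Lemma oracle_error_mixture M (f : 'I_M -> Rd -> R) (lam : 'rV[R]_M) :
  oracle_error f [set: 'rV[R]_M] (mixture f lam) = 0%E.
Proof.
apply/eqP; rewrite eq_le; apply/andP; split.
  apply: ge_ereal_inf; exists (sqL2 (mixture f lam \- mixture f lam)).
    by exists lam.
  rewrite sqL2E (eq_integral (fun=> 0%E)) ?integral0// => y _ /=.
  by rewrite subrr expr0n.
by apply: le_ereal_inf_tmp => _ [l _ <-]; exact: sqre_ge0.
Qed.

(** An upper bound dominates the average. Infinite values of [S] are treated apart: [-oo] would
    force a sum over a nonempty index set to be [-oo]. *)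
Lemma le_of_sum_le (I : finType) (r : I -> \bar R) (B : R) (S : \bar R) :
  (0 < #|I|)%N -> (forall i, r i <= S)%E ->
  ((#|I|%:R * B)%:E <= \sum_i r i)%E -> (B%:E <= S)%E.
Proof.
move=> I0 rS BS.
have {BS} : ((#|I|%:R * B)%:E <= \sum_(i : I) S)%E.
  by apply: le_trans BS _; apply: lee_sum.
case: S rS => [s|_ _|rS]; last 2 first.
- by rewrite leey.
- have [i _] : exists i : I, i \in I by move/card_gt0P: I0.
  rewrite (bigD1 i)//= addNye ?leeNy_eq//.
rewrite sumEFin sumr_const !lee_fin -[in leRHS]mulr_natl => _.
by rewrite ler_pM2l// ltr0n.
Qed.

(** With [m = M - 1] bins, the [M] functions are one baseline and one sign pattern per bin. They are
    fixed before [n]; only the size [h] of the perturbation depends on it. *)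
Lemma lower_bound (L c0 : R) M : (0 < d)%N -> 0 < L -> 0 < c0 -> (2 <= M)%N ->
  exists f : 'I_M -> Rd -> R, (forall j, f j \in Lfun leb 2%:E) /\
  forall n, (0 < n)%N -> M%:R <= c0 * n%:R ->
  forall T : estimator n, is_estimator T ->
    (((64 * (1 + c0))^-1 * (L * M%:R / n%:R))%:E
     <= max_excess_risk (bounded_densities L) [set: 'rV[R]_M] f T)%E.
Proof.
move=> d0 L0 c00; case: M => [//|m]; rewrite ltnS => m0.
have w0 : 0 < (L * m%:R)^-1 by rewrite invr_gt0 mulr_gt0// ltr0n.
have [cell [mcell trivcell lebcell]] := disjoint_cells d0 w0.
(* Bin [j] consists of the slabs [2j] and [2j + 1]; parity recovers the half and halving recovers
   the bin. *)
pose C (z : 'I_m * bool) := cell (z.1.*2 + z.2)%N.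
have mC z : measurable (C z) by exact: mcell.
have trivC z z' y : C z y -> C z' y -> z = z'.
  move=> zy z'y; have := trivcell _ _ _ zy z'y.
  case: z z' {zy z'y} => [j b] [j' b'] /= e.
  have bb : b = b'.
    by have := congr1 odd e; rewrite !oddD !odd_double /= !oddb.
  rewrite bb in e *; congr pair; apply: val_inj => /=.
  by move: e => /eqP; rewrite eqn_add2r => /eqP /double_inj.
have muC z : leb (C z) = ((L * m%:R)^-1)%:E by exact: lebcell.
(* Index [ord0] is the indicator of the whole box; every other index takes opposite signs on the two
   halves of its bin and vanishes elsewhere. *)
pose coef (j : 'I_m.+1) (z : 'I_m * bool) : R :=
  if unlift ord0 j is Some k then (z.1 == k)%:R * pm1 z.2 else 1.
exists (fun j => step C (coef j)); split.
  by move=> j; exact: (step_Lfun2 mC trivC muC).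
move=> n n0 Mn T mT.
have n0R : 0 < n%:R :> R by rewrite ltr0n.
have m0R : 0 < m%:R :> R by rewrite ltr0n.
(* This makes [n * (h ^+ 2 / m) = 1 / (4 * (1 + c0)) <= 1/4], while [M <= c0 * n] yields
   [h <= 1]. *)
pose h := Num.sqrt (m%:R / (4 * n%:R * (1 + c0))).
have hh : h ^+ 2 = m%:R / (4 * n%:R * (1 + c0)).
  by rewrite sqr_sqrtr// divr_ge0// ?mulr_ge0 ?ltW// addr_gt0.
have h0 : 0 <= h by exact: sqrtr_ge0.
have h1 : h <= 1.
  rewrite -(@expr_le1 _ 2)// hh ler_pdivrMr ?mulr_gt0 ?addr_gt0// mul1r.
  move: Mn; rewrite -natr1 => Mn; nra.
have mixE om : cube_density L h C om = mixture (fun j => step C (coef j))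
    (\row_j (if unlift ord0 j is Some k then L / 2 * h * pm1 (om k) else L / 2)).
  apply/funext => y; rewrite /mixture step_sum; congr step; apply/funext => z.
  rewrite big_ord_recl mxE /coef unlift_none mulr1 (bigD1 z.1)//= mxE liftK eqxx mul1r.
  rewrite big1 ?addr0 => [|k kz]; first by ring.
  by rewrite mxE liftK eq_sym (negbTE kz) mul0r mulr0.
(* Here [L * h ^+ 2 / 8 = L * (2 * m) / (64 * (1 + c0) * n)], and [2 * m >= m + 1 = M] since
   [m >= 1]. *)
apply: (@le_trans _ _ (L * h ^+ 2 / 8)%:E).
  rewrite lee_fin hh.
  have -> : (64 * (1 + c0))^-1 * (L * m.+1%:R / n%:R)
      = L / (64 * (1 + c0) * n%:R) * m.+1%:R.
    by field; rewrite !gt_eqF// addr_gt0.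
  have -> : L * (m%:R / (4 * n%:R * (1 + c0))) / 8
      = L / (64 * (1 + c0) * n%:R) * (2 * m%:R).
    by field; rewrite !gt_eqF// addr_gt0.
  apply: ler_wpM2l.
    by rewrite divr_ge0 ?ltW// !mulr_gt0// addr_gt0.
  by rewrite -natrM ler_nat mul2n -addnn -addn1 leq_add2l.
apply: (@le_of_sum_le _ (fun om : {ffun 'I_m -> bool} => risk T (cube_density L h C om))).
- by apply/card_gt0P; exists [ffun=> true].
(* Each vertex density is itself a mixture, so its oracle error is 0 and its excess risk equals its
   risk. *)
- move=> om; apply: ereal_sup_ubound; exists (cube_density L h C om).
    exact: cube_density_bounded.
  by rewrite {2}mixE oracle_error_mixture sube0.
apply: sum_risk_cube_ge => //.
rewrite hh [leLHS](_ : _ = 4^-1 * (1 + c0)^-1).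
  by rewrite ler_piMr ?invr_ge0// invf_le1 ?lerDl ?ltW// addr_gt0.
by field; rewrite !gt_eqF// addr_gt0.
Qed.

End lower_bound.

Theorem corollary3p1 (R : realType) (d : nat) (L c0 : R) (hd : (1 <= d)%N)
    (hL : 0 < L) (hc0 : 0 < c0) :
  let P0 : set (Rspace R d -> R) := bounded_densities L in
  let dom := fun M n : nat => (M%:R <= c0 * n%:R : Prop) in
  let psi := fun M n : nat => L * M%:R / n%:R in
  optimal_rate_of_aggregation dom P0 (fun M => [set: 'rV[R]_M]) psi /\
  exists C c : R, 0 < c /\ forall M : nat, (2 <= M)%N ->
    (forall f : 'I_M -> Rspace R d -> R,
      (forall j, f j \in Lfun (lebesgueR R d) 2%:E) ->
      (exists M' : nat, (M' <= M)%N /\ exists phi : 'I_M' -> Rspace R d -> R,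
        orthonormal_basis_of_span f phi) /\
      forall (M' : nat) (phi : 'I_M' -> Rspace R d -> R), (M' <= M)%N ->
        orthonormal_basis_of_span f phi ->
        forall n : nat, (1 <= n)%N -> dom M n ->
          is_estimator (linear_aggregate phi n) /\
          (max_excess_risk P0 [set: 'rV[R]_M] f (linear_aggregate phi n)
            <= (C * psi M n)%:E)%E)
    /\
    (exists f : 'I_M -> Rspace R d -> R,
      (forall j, f j \in Lfun (lebesgueR R d) 2%:E) /\
      forall n : nat, (1 <= n)%N -> dom M n ->
        forall T : estimator (R := R) (d := d) n, is_estimator T ->
          ((c * psi M n)%:E <= max_excess_risk P0 [set: 'rV[R]_M] f T)%E).
Proof.
move=> P0 dom psi; have L0 := ltW hL.
have c1 : 0 < (64 * (1 + c0))^-1 by rewrite invr_gt0 mulr_gt0// addr_gt0.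
(* The bound with constant 1 for an arbitrary orthonormal basis serves twice: for the existence of
   some aggregate, with a Gram-Schmidt basis chosen before [n], and for the explicit claim about
   every basis. *)
have upper M (f : 'I_M -> Rspace R d -> R) M' (phi : 'I_M' -> Rspace R d -> R) :
    (forall j, f j \in Lfun (lebesgueR R d) 2%:E) -> (M' <= M)%N ->
    orthonormal_basis_of_span f phi -> forall n, (1 <= n)%N -> dom M n ->
    is_estimator (linear_aggregate phi n) /\
    (max_excess_risk P0 [set: 'rV[R]_M] f (linear_aggregate phi n)
      <= (1 * psi M n)%:E)%E.
  move=> fL M'M phiB n n0 _; split.
    by apply: is_estimator_linear_aggregate; case: phiB.
  by rewrite mul1r; exact: max_excess_risk_linear_aggregate_le.
split; [split|].
- by move=> M n M2 n0 _; rewrite divr_gt0 ?mulr_gt0 ?ltr0n// (leq_trans _ M2).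
- exists 1 => M M2 f fL.
  have [M' [M'M [phi phiB]]] := orthonormal_basis_exists fL.
  by exists (linear_aggregate phi); exact: upper.
- exists (64 * (1 + c0))^-1; split => // M M2; exact: lower_bound.
- exists 1, (64 * (1 + c0))^-1; split => // M M2; split; last exact: lower_bound.
  move=> f fL; split; first exact: orthonormal_basis_exists.
  by move=> M' phi M'M phiB; exact: upper.
Qed.
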